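(* Let $m,n$ be positive integers. If $n\ge 2$, then $$f_m(n,2)=mn+m.$$ If $k\in\{3,4\}$ and $n\ge k-1$, then $$mn+(m+1)(k-1)-1\le f_m(n,k)\le mn+m\binom{k}{2}.$$
   Context: For positive integers $m,n$ let $mB^n=\{0,1,\ldots,m\}^n\subseteq\mathbb{R}^n$. A family of affine hyperplanes in $\mathbb{R}^n$ is a finite multiset, so repetitions are allowed and counted. A point is covered $j$ times by the family if exactly $j$ members of the multiset contain it. For a positive integer $k$, $f_m(n,k)$ denotes the minimum size of a family of affine hyperplanes in $\mathbb{R}^n$ such that every point of $mB^n\setminus\{\mathbf 0\}$ is covered at least $k$ times and the origin $\mathbf 0$ is covered by no member of the family. *)

(* Defs.v *)
From HB Require Import structures.
From mathcomp Require Import all_boot all_order all_algebra.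
From mathcomp Require Import boolp reals.
Set Implicit Arguments. Unset Strict Implicit. Unset Printing Implicit Defensive.
Import Order.TTheory GRing.Theory Num.Theory.
Local Open Scope ring_scope.

(* An affine hyperplane {x in R^n | a . x = b} is encoded by the pair (a, b)
   with a a nonzero row vector (the nonzero condition is part of [is_kcover]). *)
Definition hyperplane (R : realType) (n : nat) := ('rV[R]_n * R)%type.

Definition on_hp (R : realType) (n : nat) (h : hyperplane R n) (x : 'rV[R]_n) : bool :=
  \sum_(i < n) h.1 0 i * x 0 i == h.2.

Definition grid_pt (R : realType) (m n : nat) (x : 'I_n -> 'I_m.+1) : 'rV[R]_n :=
  \row_i ((x i : nat)%:R).

(* F (a finite multiset = list of hyperplanes) covers every point of
   m B^n \ {0} at least k times and no member contains the origin. *)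
Definition is_kcover (R : realType) (m n k : nat) (F : seq (hyperplane R n)) : Prop :=
  [/\ all (fun h => h.1 != 0) F,
      (forall x : 'I_n -> 'I_m.+1, (exists i, x i != ord0) ->
          (k <= count (fun h => on_hp h (grid_pt R x)) F)%N)
    & all (fun h => ~~ on_hp h 0) F].

Definition std_family (R : realType) (m n : nat) : seq (hyperplane R n) :=
  [seq (delta_mx 0 i, (j.+1)%:R) | i <- enum 'I_n, j <- iota 0 m].

Lemma kcover_exists (R : realType) (m n k : nat) :
  exists s : nat, `[< exists F : seq (hyperplane R n), @is_kcover R m n k F /\ size F = s >].
Proof.
exists (size (flatten (nseq k (std_family R m n)))).
apply/asboolP; exists (flatten (nseq k (std_family R m n))); split => //.
have memL : forall h, h \in flatten (nseq k (std_family R m n)) ->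
    exists i j, h = (delta_mx 0 i, (j.+1)%:R).
  move=> h /flattenP [s /nseqP [-> _]] /allpairsP [[i j] [_ _ ->]].
  by exists i, j.
split.
- apply/allP => h /memL [i [j ->]] /=.
  apply/eqP => /matrixP /(_ 0 i); rewrite !mxE !eqxx /= => /eqP.
  by rewrite oner_eq0.
- move=> x [i xi0].
  have hL : (0 < count (fun h => on_hp h (grid_pt R x)) (std_family R m n))%N.
    rewrite -has_count; apply/hasP.
    exists (delta_mx 0 i, ((x i).-1.+1)%:R).
      apply/allpairsP; exists (i, (x i).-1) => /=; split => //.
        by rewrite mem_enum.
      rewrite mem_iota /= add0n.
      have := ltn_ord (x i); move: xi0; rewrite -val_eqE /=.
      by case: (nat_of_ord (x i)).
    rewrite /on_hp /= (bigD1 i) //= big1 => [|l lneq]; last first.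
      by rewrite !mxE (negbTE lneq) andbF mul0r.
    rewrite !mxE !eqxx /= mul1r addr0 prednK //.
    by rewrite lt0n; move: xi0; rewrite -val_eqE.
  clear memL; elim: k => [//|k IH] /=.
  by rewrite count_cat -add1n leq_add.
- apply/allP => h /memL [i [j ->]] /=.
  rewrite /on_hp big1 => [|l _]; last by rewrite (_ : (0 : 'rV[R]_n) 0 l = 0) ?mulr0 // mxE.
  by rewrite eq_sym pnatr_eq0.
Qed.

Definition f_m (R : realType) (m n k : nat) : nat := ex_minn (@kcover_exists R m n k).

(* Main.v *)
Require Import Defs.
From HB Require Import structures.
From mathcomp Require Import all_boot all_order all_algebra.
From mathcomp Require Import boolp reals.
From mathcomp Require Import ring lra zify.

(* Lower bounds.  Let P be the product of the affine forms of the family.  On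
   each coordinate i take the divided difference at the nodes 0 (e_i + 1 times)
   and 1, ..., m (s_i + 1 times each), where e_i <= s_i and the s_i add up to
   k - 1.  The tensor product of these functionals kills all polynomials of
   degree less than mn + m(k - 1) + \sum_i e_i, and at a nonzero grid point it
   only involves derivatives of order less than k, which vanish for P.  Hence if
   P had small degree, a linear relation between the Taylor coefficients of P at
   the origin would hold.  Different choices of s with the same e give enough
   relations to force P(0) = 0, a contradiction.
     k = 2: s = (1), e = 0;
     k = 3: s = (2) and s = (1,1), e = (1);
     k = 4: s = (3) and s = (2,1) with e = (2); s = (1,2) and s = (1,1,1) with
            e = (1,1). *)

Set Implicit Arguments.
Unset Strict Implicit.
Unset Printing Implicit Defensive.

Import Order.TTheory GRing.Theory Num.Theory.
Local Open Scope ring_scope.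

(** * Tensor products of univariate functionals, applied to products of affine forms *)

Section TensorFunctional.
Variables (R : realType) (n : nat).
Implicit Types (F : seq (hyperplane R n)) (mu : 'I_n -> {poly R} -> R).
Implicit Types (q : 'I_n -> {poly R}).

Definition upd (T : Type) (f : 'I_n -> T) (i : 'I_n) (x : T) : 'I_n -> T :=
  fun j => if j == i then x else f j.

Lemma upd_same T (f : 'I_n -> T) i x : upd f i x i = x.
Proof. by rewrite /upd eqxx. Qed.

Lemma upd_id T (f : 'I_n -> T) i : upd f i (f i) = f.
Proof. by apply/funext => j; rewrite /upd; case: eqP => [->|]. Qed.

Lemma upd_upd T (f : 'I_n -> T) i x y : upd (upd f i x) i y = upd f i y.
Proof. by apply/funext => j; rewrite /upd; case: eqP. Qed.

Lemma upd_comm T (f : 'I_n -> T) i j x y :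
  i != j -> upd (upd f i x) j y = upd (upd f j y) i x.
Proof.
move=> ij; apply/funext => k; rewrite /upd.
by case: (eqVneq k j) => // ->; rewrite eq_sym (negbTE ij).
Qed.

(* The value of the functional [mu 0 (x) ... (x) mu (n-1)] at the polynomial
   [\prod_i (q i)(x_i) * \prod_(h <- F) (h.1 . x - h.2)] in n variables. *)
Fixpoint tens F mu q : R :=
  if F is h :: F' then
    \sum_i h.1 0 i * tens F' mu (upd q i ('X * q i)) - h.2 * tens F' mu q
  else \prod_i mu i (q i).

Lemma prod_upd mu q i p :
  \prod_j mu j (upd q i p j) = mu i p * \prod_(j | j != i) mu j (q j).
Proof.
rewrite (bigD1 i) //= upd_same; congr (_ * _).
by apply: eq_bigr => j ji; rewrite /upd (negbTE ji).
Qed.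

Lemma tens_linear_arg F mu q i a p p' : scalar (mu i) ->
  tens F mu (upd q i (a *: p + p')) =
  a * tens F mu (upd q i p) + tens F mu (upd q i p').
Proof.
move=> lin; elim: F q p p' => [|h F IH] q p p' /=.
  by rewrite !prod_upd lin mulrDl mulrA.
have step j : tens F mu (upd (upd q i (a *: p + p')) j
                           ('X * upd q i (a *: p + p') j)) =
    a * tens F mu (upd (upd q i p) j ('X * upd q i p j)) +
    tens F mu (upd (upd q i p') j ('X * upd q i p' j)).
  case: (eqVneq j i) => [->|ji].
    by rewrite !upd_same !upd_upd mulrDr -scalerAr IH.
  have E x : upd q i x j = q j by rewrite /upd (negbTE ji).
  by rewrite !E !(upd_comm _ _ _ (_ : i != j)) 1?eq_sym.
under eq_bigr => j _ do rewrite step mulrDr mulrCA.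
by rewrite big_split /= -mulr_sumr IH; ring.
Qed.

Lemma tens_linear_fun F mu q i a f g :
  tens F (upd mu i (fun p => a * f p + g p)) q =
  a * tens F (upd mu i f) q + tens F (upd mu i g) q.
Proof.
elim: F q => [|h F IH] q /=.
  have E k : \prod_j upd mu i k j (q j) = k (q i) * \prod_(j | j != i) mu j (q j).
    rewrite (bigD1 i) //= upd_same; congr (_ * _).
    by apply: eq_bigr => j ji; rewrite /upd (negbTE ji).
  by rewrite !E mulrDl mulrA.
under eq_bigr => j _ do rewrite IH mulrDr mulrCA.
by rewrite big_split /= -mulr_sumr IH; ring.
Qed.

(** Multilinear expansion; when the indices are nodes, the functions [a] run over the grid
    points. *)
Lemma tens_sum F (I : finType) (nu : 'I_n -> I -> {poly R} -> R) q :
  tens F (fun i p => \sum_a nu i a p) q =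
  \sum_(a : {ffun 'I_n -> I}) tens F (fun i => nu i (a i)) q.
Proof.
elim: F q => [|h F IH] q /=; first exact: bigA_distr_bigA.
rewrite sumrB -mulr_sumr -IH exchange_big /=; congr (_ - _).
by apply: eq_bigr => i _; rewrite IH mulr_sumr.
Qed.

(** Pigeonhole on sizes: once all affine forms are expanded, the sizes of the arguments add up to
    less than [\sum_i (D i).+1], so some coordinate has size at most [D i] and its factor is
    zero. *)
Lemma tens_small_degree F mu q (D : 'I_n -> nat) :
  (forall i (p : {poly R}), (size p <= D i)%N -> mu i p = 0) ->
  (\sum_i size (q i) + size F < \sum_i (D i).+1)%N ->
  tens F mu q = 0.
Proof.
move=> muD; elim: F q => [|h F IH] q /=.
  rewrite addn0 => lt; apply/eqP/prodf_eq0.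
  case: (pickP (fun i => size (q i) <= D i)%N) => [i le|ge].
    by exists i => //; rewrite muD.
  move: lt; rewrite ltnNge leq_sum // => i _.
  by rewrite ltnNge ge.
rewrite addnS => lt; rewrite IH 1?ltnW // mulr0 subr0 big1 // => i _.
rewrite IH ?mulr0 //; apply: leq_ltn_trans lt.
rewrite -addSn leq_add2r (bigD1 i) //= [in leqRHS](bigD1 i) //= -addSn upd_same.
apply: leq_add; last first.
  by apply: leq_sum => j ji; rewrite /upd (negbTE ji).
by apply: leq_trans (size_polyMleq _ _) _; rewrite size_polyX.
Qed.

(** Pigeonhole on orders of vanishing at [x]: [mu i] only sees Taylor coefficients of order at most
    [r i], and each form through the point raises the total order of vanishing by one, finally
    beyond [\sum_i r i]. *)
Lemma tens_vanish F mu q (x : 'I_n -> R) (r s : 'I_n -> nat) :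
  (forall i, scalar (mu i)) ->
  (forall i p, ('X - (x i)%:P) ^+ (r i).+1 %| p -> mu i p = 0) ->
  (forall i, ('X - (x i)%:P) ^+ s i %| q i) ->
  (\sum_i r i < \sum_i s i + count (fun h => on_hp h (\row_i x i)) F)%N ->
  tens F mu q = 0.
Proof.
move=> lin mur; elim: F q s => [|h F IH] q s /= dvd.
  rewrite addn0 => lt; apply/eqP/prodf_eq0.
  case: (pickP (fun i => r i < s i)%N) => [i le|ge].
    exists i => //; rewrite mur //; apply: dvdp_trans (dvd i).
    exact: dvdp_exp2l.
  by move: lt; rewrite ltnNge leq_sum // => i _; rewrite leqNgt ge.
move=> lt.
(* Recentring ['X] at [x i]: the constants collect to the value of the form at the point, which is
   zero when [h] contains it; every other term gains a factor ['X - (x i)%:P]. *)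
have E i : tens F mu (upd q i ('X * q i)) =
    tens F mu (upd q i (('X - (x i)%:P) * q i)) + x i * tens F mu q.
  have -> : tens F mu q = tens F mu (upd q i (q i)) by rewrite upd_id.
  rewrite addrC -tens_linear_arg //; congr (tens _ _ (upd _ _ _)).
  by rewrite mulrBl mul_polyC addrC subrK.
under eq_bigr => i _ do rewrite E mulrDr.
rewrite big_split /= -addrA.
have -> : \sum_i h.1 0 i * (x i * tens F mu q) - h.2 * tens F mu q =
    (\sum_i h.1 0 i * x i - h.2) * tens F mu q.
  by rewrite mulrBl mulr_suml; under eq_bigr => i _ do rewrite mulrA.
have S i : (\sum_j upd s i (s i).+1 j = (\sum_j s j).+1)%N.
  rewrite (bigD1 i) //= upd_same [in RHS](bigD1 i) //= -addSn; congr addn.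
  by apply: eq_bigr => j ji; rewrite /upd (negbTE ji).
rewrite big1 ?add0r; last first.
  move=> i _; rewrite (IH _ (upd s i (s i).+1)) ?mulr0 //.
    move=> j; rewrite /upd; case: (eqVneq j i) => [->|_]; last exact: dvd.
    by rewrite exprS dvdp_mul.
  by rewrite S; apply: leq_trans lt _; rewrite addSn -addnS leq_add2l; case: on_hp.
have onE : on_hp h (\row_i x i) = (\sum_i h.1 0 i * x i == h.2).
  by rewrite /on_hp; under eq_bigr => i _ do rewrite mxE.
move: lt; rewrite onE; case: eqP => [-> _|_ lt]; first by rewrite subrr mul0r.
by rewrite (IH _ s) ?mulr0.
Qed.

Lemma tens_coef0 F : tens F (fun _ p => p`_0) (fun=> 1) = \prod_(h <- F) - h.2.
Proof.
elim: F => [|h F IH] /=.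
  by rewrite big_nil big1 // => i _; rewrite coef1.
rewrite big_cons IH big1 ?add0r ?mulNr // => i _.
rewrite (@tens_vanish _ _ _ (fun=> 0) (fun=> 0%N) (fun j => (j == i) : nat)) ?mulr0 //.
- by move=> j a p p'; rewrite coefD coefZ.
- by move=> j p; rewrite subr0 expr1 => /dvdpP[p' ->]; rewrite coefMX.
- move=> j; rewrite /upd; case: (eqVneq j i) => _; last exact: dvd1p.
  by rewrite mulr1 subr0 expr1 dvdpp.
- by rewrite big1 // (bigD1 i) //= eqxx.
Qed.

End TensorFunctional.

(** * Partitions of unity modulo pairwise coprime polynomials *)

Section Univariate.
Variable K : fieldType.

(** The [eps a] are Chinese remainder idempotents. With [G] the product of the earlier [g b], a
    Bezout identity [u * g m + w * G = 1] multiplies the old ones by [u * g m] and supplies [w * G]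
    as the new one. *)
Lemma partition_of_unity (g : nat -> {poly K}) (m : nat) :
  (forall a b, a != b -> coprimep (g a) (g b)) ->
  exists2 eps : nat -> {poly K},
    \prod_(b < m) g b %| 1 - \sum_(a < m) eps a &
    forall a, (a < m)%N -> \prod_(b < m) g b %| g a * eps a.
Proof.
move=> cop; elim: m => [|m [eps unit dvd]].
  by exists (fun=> 0); rewrite // !big_ord0 dvd1p.
have /Bezout_eq1_coprimepP[[u w] /= uw1] : coprimep (g m) (\prod_(b < m) g b).
  elim/big_rec: _ => [|b p _ cp]; first exact: coprimep1.
  by rewrite coprimepMr cp andbT cop // gtn_eqF.
exists (fun a => if (a < m)%N then u * g m * eps a else w * \prod_(b < m) g b).
  rewrite !big_ord_recr /= ltnn.
  under [X in 1 - (X + _)]eq_bigr => a _ do rewrite ltn_ord.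
  rewrite -mulr_sumr; set G := \prod_(b < m) g b in uw1 unit *.
  have -> : 1 - (u * g m * \sum_(a < m) eps a + w * G) =
      u * (g m * (1 - \sum_(a < m) eps a)).
    by rewrite -[X in X - _]uw1; ring.
  by apply: dvdp_mull; rewrite mulrC dvdp_mul.
move=> a; rewrite ltnS leq_eqVlt big_ord_recr /= => /predU1P[->|lt].
  by rewrite ltnn mulrCA dvdp_mull // mulrC dvdpp.
rewrite lt [X in _ %| X](_ : _ = u * (g a * eps a * g m)); last by ring.
by rewrite dvdp_mull // dvdp_mul // dvd.
Qed.

End Univariate.

(** * Divided differences with repeated nodes, via jets at the node 0 *)

Section DividedDifference.
Variable R : realType.
Implicit Types (p q : {poly R}).

(* Modulo X^3, [trunc_inv m] is the inverse of [\prod_(1 <= a <= m) (1 - X/a)]. *)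
Definition trunc_inv (m : nat) : {poly R} :=
  \prod_(a < m) (1 + (a.+1)%:R^-1 *: 'X + (a.+1)%:R^-1 ^+ 2 *: 'X^2).

(* [jet m e t p] is the coefficient of X^e in p / \prod_(1 <= a <= m) (1 - X/a)^t
   for [e <= 2] only, because of the truncation. *)
Definition jet (m e t : nat) (p : {poly R}) : R := (p * trunc_inv m ^+ t)`_e.

Lemma coef1M p q : (p * q)`_1 = p`_0 * q`_1 + p`_1 * q`_0.
Proof. by rewrite coefM !big_ord_recr big_ord0 /= add0r. Qed.

Lemma coef2M p q : (p * q)`_2 = p`_0 * q`_2 + p`_1 * q`_1 + p`_2 * q`_0.
Proof. by rewrite coefM !big_ord_recr big_ord0 /= add0r. Qed.

Lemma jet_scalar m e t : scalar (jet m e t).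
Proof. by move=> a p q; rewrite /jet mulrDl -scalerAl coefD coefZ. Qed.

Lemma jet_dvd m e t p : 'X ^+ e.+1 %| p -> jet m e t p = 0.
Proof. by case/dvdpP => q ->; rewrite /jet mulrAC coefMXn ltnSn. Qed.

Lemma trunc_inv_coefs m :
  [/\ (trunc_inv m)`_0 = 1, 0 <= (trunc_inv m)`_1, (0 < m)%N -> 0 < (trunc_inv m)`_1
    & 0 <= (trunc_inv m)`_2].
Proof.
elim: m => [|m [u0 u1 _ u2]].
  by rewrite /trunc_inv big_ord0 !coef1.
have b0 : 0 < (m.+1)%:R^-1 :> R by rewrite invr_gt0 ltr0n.
have -> : trunc_inv m.+1 = trunc_inv m *
    (1 + (m.+1)%:R^-1 *: 'X + (m.+1)%:R^-1 ^+ 2 *: 'X^2).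
  by rewrite /trunc_inv big_ord_recr.
set b := _^-1 in b0 *.
rewrite coef0M coef1M coef2M u0 !coefD !coefZ !coef1 !coefX !coefXn /=.
by split; nra.
Qed.

Lemma trunc_invX_coefs m t (u := trunc_inv m) :
  [/\ (u ^+ t)`_0 = 1, (u ^+ t)`_1 = t%:R * u`_1
    & (u ^+ t)`_2 = t%:R * u`_2 + 'C(t, 2)%:R * u`_1 ^+ 2].
Proof.
have [u0 _ _ _] := trunc_inv_coefs m.
elim: t => [|t [e0 e1 e2]].
  by rewrite expr0 !coef1 bin_small //= !mulr0n !mul0r addr0.
rewrite exprS coef0M coef1M coef2M e0 e1 e2 u0 binS bin1 natrD -natr1.
by split; ring.
Qed.

Lemma jet0E m t p : jet m 0 t p = p`_0.
Proof. by have [e _ _] := trunc_invX_coefs m t; rewrite /jet coef0M e mulr1. Qed.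

Lemma jet1E m t p : jet m 1 t p = (t%:R * (trunc_inv m)`_1) * p`_0 + p`_1.
Proof.
by have [e0 e1 _] := trunc_invX_coefs m t; rewrite /jet coef1M e0 e1; ring.
Qed.

Lemma jet2E m t p : jet m 2 t p =
  (t%:R * (trunc_inv m)`_2 + 'C(t, 2)%:R * (trunc_inv m)`_1 ^+ 2) * p`_0 +
  ((t%:R * (trunc_inv m)`_1) * p`_1 + p`_2).
Proof.
by have [e0 e1 e2] := trunc_invX_coefs m t; rewrite /jet coef2M e0 e1 e2; ring.
Qed.

Definition node_poly (m t : nat) : {poly R} :=
  \prod_(a < m) ('X - (a.+1)%:R%:P) ^+ t.

Lemma node_poly_monic m t : node_poly m t \is monic.
Proof. by apply: monic_prod => a _; apply: monic_exp; apply: monicXsubC. Qed.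

Lemma size_node_poly m t : size (node_poly m t) = (m * t).+1.
Proof.
elim: m => [|m IH]; first by rewrite /node_poly big_ord0 size_poly1.
have -> : node_poly m.+1 t = node_poly m t * ('X - (m.+1)%:R%:P) ^+ t.
  by rewrite /node_poly big_ord_recr.
rewrite size_Mmonic ?monic_neq0 ?node_poly_monic ?monic_exp ?monicXsubC //.
by rewrite IH size_exp_XsubC mulSn addnS /= addSn addnC.
Qed.

(** Since [(X - a)(1 + X/a + X^2/a^2) = X^3/a^2 - a], every factor is constant modulo [X^3], hence
    so is the product. *)
Lemma node_poly_flat m t (g := node_poly m t * trunc_inv m ^+ t) :
  g`_1 = 0 /\ g`_2 = 0.
Proof.
rewrite {}/g /node_poly prodrXl -exprMn -big_split /=.
pose flat (p : {poly R}) := p`_1 = 0 /\ p`_2 = 0.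
have flat1 : flat 1 by rewrite /flat !coef1.
have flatM p q : flat p -> flat q -> flat (p * q).
  by move=> [p1 p2] [q1 q2]; rewrite /flat coef1M coef2M p1 p2 q1 q2; split; ring.
have flatX p : flat p -> flat (p ^+ t).
  by move=> fp; elim: t => [|k IH]; rewrite ?expr0 // exprS; apply: flatM.
apply: flatX; apply: (big_ind flat) => // a _; rewrite /flat.
rewrite coef1M coef2M !coefB !coefD !coefZ !coef1 !coefC !coefX !coefXn /=.
by split; field; rewrite nat1r pnatr_eq0.
Qed.

(** By flatness the product is a constant times [q] modulo [X^3], and [q] has degree less than
    [e]. *)
Lemma jet_node_poly m e t q : (e <= 2)%N -> (size q <= e)%N ->
  jet m e t (q * node_poly m t) = 0.
Proof.
move=> e2 qe; have [g1 g2] := node_poly_flat m t.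
rewrite /jet -mulrA coefM big1 // => -[j /=]; rewrite ltnS => je _.
case: (ltngtP j e) je => // [lt _|-> _]; last by rewrite nth_default ?mul0r.
suff -> : (node_poly m t * trunc_inv m ^+ t)`_(e - j) = 0 by rewrite mulr0.
by have /orP[/eqP->|/eqP->] : (e - j == 1)%N || (e - j == 2)%N by lia.
Qed.

(* The divided difference at the nodes [0^(e+1), 1^t, ..., m^t], split according
   to the nodes and normalised at the node 0. *)
Lemma divided_difference m e t : (e <= 2)%N ->
  exists nu : nat -> {poly R} -> R,
  [/\ nu 0%N = jet m e t, forall a, scalar (nu a),
      forall a p, (a < m)%N -> ('X - (a.+1)%:R%:P) ^+ t %| p -> nu a.+1 p = 0
    & forall p, (size p <= e + m * t)%N -> \sum_(a < m.+1) nu a p = 0].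
Proof.
move=> e2; pose g a : {poly R} := ('X - (a.+1)%:R%:P) ^+ t.
have [a b ab|eps unit dvd] := @partition_of_unity R g m.
  apply/coprimep_expl/coprimep_expr/coprimep_XsubC2.
  by rewrite subr_eq0 eqr_nat eqSS eq_sym.
pose V := node_poly m t.
have VE : \prod_(b < m) g b = V by [].
rewrite VE in unit dvd.
(* Modulo [V], [eps b * p] depends only on [p] modulo [g b], which localises this functional at the
   node [b + 1]. The minus sign makes the total equal to the jet of [p - p %% V]. *)
pose nu a p := if a is b.+1 then - jet m e t ((eps b * p) %% V) else jet m e t p.
have jetD p q : jet m e t (p + q) = jet m e t p + jet m e t q.
  by rewrite -[p]scale1r jet_scalar mul1r scale1r.
have jet0 : jet m e t 0 = 0 by rewrite /jet mul0r coef0.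
exists nu; split=> //.
- case=> [|b] c p q; first exact: jet_scalar.
  by rewrite /nu mulrDr -scalerAr modpD modpZl jet_scalar; ring.
- move=> a p am /dvdpP[q ->]; rewrite /nu modp_eq0 ?jet0 ?oppr0 //.
  by rewrite mulrCA dvdp_mull // mulrC dvd.
move=> p sp; rewrite big_ord_recl /=.
rewrite (_ : \sum_(i < m) _ = - jet m e t (p %% V)); last first.
  have -> : p %% V = \sum_(i < m) (eps i * p) %% V.
    rewrite -[p in LHS]mul1r -[1](subrK (\sum_(i < m) eps i)) mulrDl modpD.
    rewrite modp_eq0 ?dvdp_mulr // add0r mulr_suml.
    by elim/big_rec2: _ => [|i p1 p2 _ <-]; rewrite ?mod0p ?modpD.
  rewrite (big_morph (jet m e t) jetD jet0) -sumrN.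
  by apply: eq_bigr.
(* Only the jet of [(p %/ V) * V] is left, and the bound on [p] gives the quotient size at most
   [e]. *)
rewrite [in jet m e t p](divp_eq p V) jetD addrK jet_node_poly //.
rewrite size_divp ?monic_neq0 ?node_poly_monic // size_node_poly /=.
by rewrite leq_subLR addnC.
Qed.

End DividedDifference.

(** * Lower bounds from linear relations between Taylor coefficients at the origin *)

Section LowerBound.
Variables (R : realType) (m n : nat).
Implicit Types (F : seq (hyperplane R n)) (e s : 'I_n -> nat).

(** The functional summed over all nodes vanishes by degree. In its expansion over the grid, a
    nonzero point contributes zero: the orders seen there add up to at most [\sum_i s i < k], while
    at least [k] forms vanish. Only the origin term remains. *)
Lemma jet_relation k F e s : is_kcover m k F ->
  (forall i, e i <= s i)%N -> (forall i, e i <= 2)%N -> (\sum_i s i < k)%N ->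
  (size F < m * n + m * \sum_i s i + \sum_i e i)%N ->
  tens F (fun i => jet m (e i) (s i).+1) (fun=> 1) = 0.
Proof.
move=> [_ cover _] es e2 sk szF.
have /choice[nu nuP] i := divided_difference R m (s i).+1 (e2 i).
have : tens F (fun i p => \sum_(a < m.+1) nu i a p) (fun=> 1) = 0.
  apply: (@tens_small_degree _ _ _ _ _ (fun i => e i + m * (s i).+1)%N) => [i p|].
    by have [_ _ _] := nuP i; apply.
  (* The argument 1 has size 1 in each coordinate; these [n] units cancel the successors in the
     degree bound. *)
  under eq_bigr => i _ do rewrite size_poly1.
  under [ltnRHS]eq_bigr => i _ do rewrite -addn1 mulnS addnA.
  rewrite !big_split /= -big_distrr /= !sum_nat_const card_ord.
  by move: szF; move: (\sum_i s i)%N (\sum_i e i)%N => A B; lia.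
rewrite tens_sum (bigD1 [ffun=> ord0]) //= big1 ?addr0 => [|a a0].
  move=> <-; congr tens; apply/funext => i.
  by rewrite ffunE; case: (nuP i) => ->.
have cov : (k <= count (fun h => on_hp h (grid_pt R a)) F)%N.
  apply: cover; apply/existsP; apply: contraNT a0 => /existsPn a0.
  by apply/eqP/ffunP => i; rewrite ffunE; apply/eqP; rewrite -[_ == _]negbK a0.
apply: (@tens_vanish _ _ _ _ _ (fun i => (a i : nat)%:R)
    (fun i => if a i == ord0 then e i else s i) (fun=> 0%N)) => [i|i p|i|].
- by case: (nuP i).
- case: (nuP i) => nu0 _ nuV _; case: (eqVneq (a i) ord0) => [->|ai].
    by rewrite nu0 subr0; apply: jet_dvd.
  case: (a i) ai => -[//|b] bm _ /=; exact: nuV.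
- by rewrite expr0 dvd1p.
- rewrite [X in (_ < X + _)%N]big1 // add0n; apply: leq_ltn_trans (leq_trans sk cov).
  by apply: leq_sum => i _; case: ifP.
Qed.

Lemma sum_delta (i : 'I_n) : (\sum_j (j == i) = 1)%N.
Proof. by rewrite (bigD1 i) //= eqxx big1 // => j /negbTE->. Qed.

Lemma tens_origin_neq0 k F : is_kcover m k F ->
  tens F (fun _ p => p`_0) (fun=> 1) != 0.
Proof.
case=> _ _ /allP F0; rewrite tens_coef0 prodf_seq_neq0.
apply/allP => h /F0; rewrite /on_hp big1 => [|i _]; last by rewrite mxE mulr0.
by rewrite oppr_eq0 eq_sym.
Qed.

Lemma lower_bound2 F (i0 : 'I_n) :
  is_kcover m 2 F -> (m * n + m <= size F)%N.
Proof.
move=> cov; rewrite leqNgt; apply/negP => lt.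
have /eqP := tens_origin_neq0 cov; apply.
(* With [e = 0] all jets are evaluations at 0, so the relation itself says that the product vanishes
   at the origin. *)
rewrite -[RHS](@jet_relation 2 F (fun=> 0%N) (fun i => i == i0) cov) //.
- by congr tens; apply/funext => i; apply/funext => p; rewrite jet0E.
- by rewrite sum_delta.
- by rewrite sum_delta muln1 big1 // addn0.
Qed.

(** Multilinearity isolates the dependence on [s] in scalar coefficients: the Taylor coefficients on
    the right do not involve [s], so relations for different [s] can be compared. The next two
    lemmas do the same at order two. *)
Lemma tens_jet1 F (i0 : 'I_n) s :
  tens F (fun i => jet m (i == i0) (s i).+1) (fun=> 1) =
  (s i0).+1%:R * (trunc_inv R m)`_1 * tens F (fun _ p => p`_0) (fun=> 1) +
  tens F (fun i p => p`_(i == i0)) (fun=> 1).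
Proof.
pose base : 'I_n -> {poly R} -> R := fun _ p => p`_0.
transitivity (tens F (upd base i0
    (fun p => (s i0).+1%:R * (trunc_inv R m)`_1 * p`_0 + p`_1)) (fun=> 1)).
  congr tens; apply/funext => i; apply/funext => p; rewrite /upd.
  by case: eqP => [->|_]; rewrite ?jet1E ?jet0E.
rewrite tens_linear_fun; congr (_ * _ + _); congr tens; apply/funext => i.
  by rewrite /upd; case: eqP.
by rewrite /upd; case: eqP.
Qed.

Lemma tens_jet2 F (i0 : 'I_n) s :
  tens F (fun i => jet m (2 * (i == i0)) (s i).+1) (fun=> 1) =
  ((s i0).+1%:R * (trunc_inv R m)`_2 +
     'C((s i0).+1, 2)%:R * (trunc_inv R m)`_1 ^+ 2) *
    tens F (fun _ p => p`_0) (fun=> 1) +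
  ((s i0).+1%:R * (trunc_inv R m)`_1 * tens F (fun i p => p`_(i == i0)) (fun=> 1) +
   tens F (fun i p => p`_(2 * (i == i0))) (fun=> 1)).
Proof.
pose base : 'I_n -> {poly R} -> R := fun _ p => p`_0.
transitivity (tens F (upd base i0
    (fun p => ((s i0).+1%:R * (trunc_inv R m)`_2 +
     'C((s i0).+1, 2)%:R * (trunc_inv R m)`_1 ^+ 2) * p`_0 +
     ((s i0).+1%:R * (trunc_inv R m)`_1 * p`_1 + p`_2))) (fun=> 1)).
  congr tens; apply/funext => i; apply/funext => p; rewrite /upd.
  by case: eqP => [->|_]; rewrite ?jet2E ?jet0E.
rewrite !tens_linear_fun; congr (_ * _ + (_ * _ + _)); congr tens; apply/funext => i.
- by rewrite /upd; case: eqP.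
- by rewrite /upd; case: eqP.
- by rewrite /upd; case: eqP.
Qed.

Lemma tens_jet11 F (i0 i1 : 'I_n) s : i0 != i1 ->
  tens F (fun i => jet m ((i == i0) + (i == i1)) (s i).+1) (fun=> 1) =
  (s i1).+1%:R * (trunc_inv R m)`_1 *
    ((s i0).+1%:R * (trunc_inv R m)`_1 * tens F (fun _ p => p`_0) (fun=> 1) +
     tens F (fun i p => p`_(i == i0)) (fun=> 1)) +
  ((s i0).+1%:R * (trunc_inv R m)`_1 * tens F (fun i p => p`_(i == i1)) (fun=> 1) +
   tens F (fun i p => p`_((i == i0) + (i == i1))) (fun=> 1)).
Proof.
move=> i01.
pose base : 'I_n -> {poly R} -> R := fun _ p => p`_0.
pose c i : {poly R} -> R := fun p => (s i).+1%:R * (trunc_inv R m)`_1 * p`_0 + p`_1.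
transitivity (tens F (upd (upd base i0 (c i0)) i1 (c i1)) (fun=> 1)).
  congr tens; apply/funext => i; apply/funext => p; rewrite /upd.
  case: (eqVneq i i1) => [->|_]; first by rewrite eq_sym (negbTE i01) jet1E.
  by case: eqP => [->|_]; rewrite ?jet1E ?jet0E.
rewrite tens_linear_fun !(upd_comm _ _ _ i01) !tens_linear_fun.
congr (_ * (_ * _ + _) + (_ * _ + _)); congr tens; apply/funext => i.
all: apply/funext => p; rewrite /upd /base.
all: case: (eqVneq i i0) => [E|_]; first by rewrite ?E ?(negbTE i01).
all: by case: (eqVneq i i1).
Qed.

Lemma lower_bound3 F (i0 i1 : 'I_n) : (0 < m)%N -> i0 != i1 ->
  is_kcover m 3 F -> (m * n + (m + 1) * 2 - 1 <= size F)%N.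
Proof.
move=> m0 i01 cov; rewrite leqNgt; apply/negP => lt.
have [_ _ /(_ m0) u1 _] := trunc_inv_coefs R m.
have /eqP := tens_origin_neq0 cov; apply.
have rel s : (forall i, (i == i0) <= s i)%N -> (\sum_i s i = 2)%N ->
    tens F (fun i => jet m (i == i0) (s i).+1) (fun=> 1) = 0.
  move=> es ss; apply: (jet_relation cov) => //; first by move=> i; case: eqP.
    by rewrite ss.
  by rewrite ss sum_delta; lia.
have := rel (fun i => 2 * (i == i0))%N; have := rel (fun i => (i == i0) + (i == i1))%N.
rewrite !tens_jet1 eqxx (negbTE i01) big_split -big_distrr /= !sum_delta.
move=> r1 r2.
have {}r1 := r1 (fun i => leq_addr _ _) erefl.
have {}r2 := r2 (fun i => leq_addr _ _) erefl.
(* With [a > 0] the linear coefficient of [trunc_inv], and [T], [T1] the constant and [i0]-linear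
   coefficients of the product, the relations read [2aT + T1 = 0] and [3aT + T1 = 0], so
   [aT = 0]. *)
apply: (mulfI (lt0r_neq0 u1)); rewrite mulr0.
by lra.
Qed.

Lemma lower_bound4 F (i0 i1 i2 : 'I_n) : (0 < m)%N ->
  i0 != i1 -> i0 != i2 -> i1 != i2 ->
  is_kcover m 4 F -> (m * n + (m + 1) * 3 - 1 <= size F)%N.
Proof.
move=> m0 i01 i02 i12 cov; rewrite leqNgt; apply/negP => lt.
have [_ _ /(_ m0) u1 u2] := trunc_inv_coefs R m.
have /eqP := tens_origin_neq0 cov; apply.
have rel e s : (forall i, e i <= s i)%N -> (forall i, e i <= 2)%N ->
    (\sum_i s i = 3)%N -> (\sum_i e i = 2)%N ->
    tens F (fun i => jet m (e i) (s i).+1) (fun=> 1) = 0.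
  move=> es e2 ss se; apply: (jet_relation cov) => //; first by rewrite ss.
  by rewrite ss se; lia.
have := rel (fun i => 2 * (i == i0))%N (fun i => 3 * (i == i0))%N.
have := rel (fun i => 2 * (i == i0))%N (fun i => 2 * (i == i0) + (i == i1))%N.
have := rel (fun i => (i == i0) + (i == i1))%N (fun i => (i == i0) + 2 * (i == i1))%N.
have := rel (fun i => (i == i0) + (i == i1))%N
            (fun i => (i == i0) + (i == i1) + (i == i2))%N.
rewrite !tens_jet2 !(tens_jet11 _ _ i01) !big_split /= !sum_delta !big1_eq.
rewrite !eqxx !(eq_sym i1 i0) (negbTE i01) (negbTE i02) (negbTE i12) /=.
move=> r1 r2 r3 r4.
have {}r1 := r1 ltac:(lia) ltac:(lia) erefl erefl.
have {}r2 := r2 ltac:(lia) ltac:(lia) erefl erefl.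
have {}r3 := r3 ltac:(lia) ltac:(lia) erefl erefl.
have {}r4 := r4 ltac:(lia) ltac:(lia) erefl erefl.
have C3 : 'C((2 * 1 + 0).+1, 2) = 3%N by [].
have C4 : 'C((3 * 1).+1, 2) = 6%N by [].
rewrite C3 in r3; rewrite C4 in r4.
move: r1 r2 r3 r4.
set T := tens F (fun _ p => p`_0) _; set T1 := tens F (fun i p => p`_(i == i0)) _.
set T2 := tens F (fun i p => p`_(i == i1)) _.
set T11 := tens F (fun i p => p`_((i == i0) + (i == i1))) _.
set T02 := tens F (fun i p => p`_(2 * (i == i0))) _.
set a := _`_1 in u1 *; set b := _`_2 in u2 * => r1 r2 r3 r4.
(* [r4 - r3] reads [(b + 3a^2)T + a T1 = 0] and [r2 - r1] reads [2a^2 T + a T1 = 0]; their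
   difference is the claim, and [b + a^2 > 0]. *)
have /eqP : (b + a ^+ 2) * T = 0 by lra.
by rewrite mulf_eq0 gt_eqF ?ltr_wpDl ?exprn_gt0 // => /eqP.
Qed.

End LowerBound.

(** * Upper bound: coordinate hyperplanes together with coordinate-sum hyperplanes *)

Section UpperBound.
Variables (R : realType) (m n : nat).

Definition sum_hps (t : nat) : seq (hyperplane R n) :=
  [seq (const_mx 1, (j.+1)%:R) | j <- iota 0 (m * t)].

(* A point with support of size w lies on w of the hyperplanes [x_i = j], and
   its coordinate sum is at most [m * w], so it lies on one hyperplane of
   [sum_hps t] for every [t >= w]. *)
Fixpoint upper_family (k : nat) : seq (hyperplane R n) :=
  if k is k'.+1 then sum_hps k' ++ upper_family k' else std_family R m n.

Lemma size_upper_family k : size (upper_family k) = (m * n + m * 'C(k, 2))%N.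
Proof.
elim: k => [|k IH] /=.
  by rewrite muln0 addn0 size_allpairs size_enum_ord size_iota mulnC.
by rewrite size_cat IH size_map size_iota binS bin1; lia.
Qed.

Lemma count_std_family (x : 'I_n -> 'I_m.+1) :
  (#|[pred i | x i != ord0]| <= count (fun h => on_hp h (grid_pt R x)) (std_family R m n))%N.
Proof.
rewrite /std_family count_flatten -map_comp sumnE big_map big_enum /= -sum1_card.
rewrite big_mkcond /=; apply: leq_sum => i _; rewrite inE; case: ifP => // xi.
rewrite -has_count has_map; apply/hasP; exists (x i).-1.
  rewrite mem_iota /= add0n; have := ltn_ord (x i).
  by move: xi; rewrite -val_eqE /=; lia.
rewrite /= /on_hp /= (bigD1 i) //= big1 => [|l li].
  by rewrite !mxE !eqxx mul1r addr0 prednK // lt0n; move: xi; rewrite -val_eqE.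
by rewrite !mxE (negbTE li) andbF mul0r.
Qed.

Lemma count_sum_hps (x : 'I_n -> 'I_m.+1) t : (exists i, x i != ord0) ->
  (#|[pred i | x i != ord0]| <= t)%N ->
  (0 < count (fun h => on_hp h (grid_pt R x)) (sum_hps t))%N.
Proof.
move=> [i xi] wt; rewrite -has_count has_map; apply/hasP.
have S0 : (0 < \sum_i x i)%N.
  by rewrite (bigD1 i) //= addn_gt0 lt0n; move: xi; rewrite -val_eqE /= => ->.
exists (\sum_i x i).-1.
  rewrite mem_iota /= add0n prednK //.
  apply: (@leq_trans (m * #|[pred i | x i != ord0]|)); last by rewrite leq_mul2l wt orbT.
  rewrite -sum1_card big_distrr /= [leqRHS]big_mkcond /=.
  apply: leq_sum => j _; rewrite inE; case: (eqVneq (x j) ord0) => [->//|_] /=.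
  by rewrite muln1 -ltnS ltn_ord.
rewrite /= /on_hp /= prednK // natr_sum; apply/eqP/eq_bigr => j _.
by rewrite !mxE mul1r.
Qed.

Lemma upper_family_cover k : (0 < n)%N -> is_kcover m k (upper_family k).
Proof.
move=> n0.
have memF (P : pred (hyperplane R n)) :
    (forall i j, P (delta_mx 0 i, (j.+1)%:R)) ->
    (forall j, P (const_mx 1, (j.+1)%:R)) -> all P (upper_family k).
  move=> P1 P2; elim: k => [|k' IH] /=.
    by apply/allP => h /allpairsP[[i j] [_ _ ->]].
  by rewrite all_cat IH andbT all_map; apply/allP => j _ /=.
split.
- apply: memF => [i j|j] /=; apply/eqP => /matrixP.
    by move/(_ 0 i); rewrite !mxE !eqxx => /eqP; rewrite oner_eq0.
  by move/(_ 0 (Ordinal n0)); rewrite !mxE => /eqP; rewrite oner_eq0.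
- move=> x x0; set w := #|[pred i | x i != ord0]|.
  have std k' : (w <= count (fun h => on_hp h (grid_pt R x)) (upper_family k'))%N.
    elim: k' => [|k' IH] /=; first exact: count_std_family.
    by rewrite count_cat (leq_trans IH) ?leq_addl.
  elim: k {memF} => [//|k' IH] /=; rewrite count_cat.
  (* If [w > k'], the coordinate hyperplanes alone cover often enough; otherwise [sum_hps k'] adds
     one to the [k'] given by induction. *)
  have [wk|kw] := leqP w k'; last first.
    by apply: leq_trans kw (leq_trans (std k') _); rewrite leq_addl.
  by rewrite -add1n leq_add ?count_sum_hps.
- apply: memF => [i j|j]; rewrite /on_hp big1 /= 1?eq_sym ?pnatr_eq0 // => l _.
    by rewrite !mxE mulr0.
  by rewrite !mxE mulr0.
Qed.

End UpperBound.

Theorem theorem1p4 (R : realType) (m n : nat) :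
  (0 < m)%N -> (0 < n)%N ->
  ((2 <= n)%N -> f_m R m n 2 = (m * n + m)%N) /\
  (forall k : nat, k \in [:: 3; 4]%N -> (k - 1 <= n)%N ->
     (m * n + (m + 1) * (k - 1) - 1 <= f_m R m n k <= m * n + m * 'C(k, 2))%N).
Proof.
move=> m0 n0.
have upper k : (f_m R m n k <= m * n + m * 'C(k, 2))%N.
  rewrite /f_m; case: ex_minnP => s _; apply; apply/asboolP.
  exists (upper_family R m n k).
  by split; [apply: upper_family_cover | apply: size_upper_family].
have lower k b : (forall F : seq (hyperplane R n), is_kcover m k F -> b <= size F)%N ->
    (b <= f_m R m n k)%N.
  by move=> lb; rewrite /f_m; case: ex_minnP => s /asboolP[F [/lb + <-]].
split=> [_|k].
  apply/eqP; rewrite eqn_leq lower ?andbT; last first.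
    by move=> F; apply: lower_bound2 (Ordinal n0).
  by have := upper 2%N; rewrite binn muln1.
rewrite !inE => /orP[/eqP->|/eqP->] kn; rewrite upper andbT; apply: lower => F.
  have n1 : (1 < n)%N by lia.
  exact: (@lower_bound3 _ _ _ _ (Ordinal n0) (Ordinal n1)).
have n1 : (1 < n)%N by lia.
have n2 : (2 < n)%N by lia.
exact: (@lower_bound4 _ _ _ _ (Ordinal n0) (Ordinal n1) (Ordinal n2)).
Qed.
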